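(* Let $X$ be a fixed $n\times n$ matrix and let $\Omega$ be drawn from the Bernoulli model with parameter $p\in(0,1]$. There is a numerical constant $C_0$ such that for each $\beta>2$, provided $np\ge\beta\log n$, $$p^{-1}\,\|(\mathcal{P}_\Omega-p\mathcal{I})(X)\|\le C_0\Big(\frac{\beta n\log n}{p}\Big)^{1/2}\|X\|_\infty$$ with probability at least $1-n^{-\beta}$.
   Context: Bernoulli model: $\{\delta_{ab}\}_{1\le a,b\le n}$ are i.i.d. $0/1$ variables with $\mathbb{P}(\delta_{ab}=1)=p$, $\Omega=\{(a,b):\delta_{ab}=1\}$; $\mathcal{P}_\Omega(X)$ keeps the entries of $X$ in $\Omega$ and zeroes the others; $\mathcal{I}$ is the identity, so $(\mathcal{P}_\Omega-p\mathcal{I})(X)=\mathcal{P}_\Omega(X)-pX$. $\|\cdot\|$ is the spectral norm and $\|X\|_\infty=\max_{ab}|X_{ab}|$. *)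

(* Defs.v *)
From Stdlib Require Import Reals List ClassicalEpsilon.
Import ListNotations.
Open Scope R_scope.

Definition rsum (n : nat) (f : nat -> R) : R :=
  fold_right Rplus 0 (map f (seq 0 n)).

(* An n x n real matrix: entries X a b for a, b < n (other values ignored). *)
Definition mat := nat -> nat -> R.
Definition vec := nat -> R.

Definition vnorm (n : nat) (x : vec) : R := sqrt (rsum n (fun i => x i * x i)).

Definition matvec (n : nat) (M : mat) (x : vec) : vec :=
  fun a => rsum n (fun b => M a b * x b).

(* ||M|| <= t for the spectral (l2 -> l2 operator) norm:
   ||M|| = inf { t : forall x, |Mx| <= t |x| }, so ||M|| <= t iff
   forall x, |Mx| <= t |x|. *)
Definition specnorm_le (n : nat) (M : mat) (t : R) : Prop :=
  forall x : vec, vnorm n (matvec n M x) <= t * vnorm n x.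

Definition infnorm (n : nat) (X : mat) : R :=
  fold_right Rmax 0
    (flat_map (fun a => map (fun b => Rabs (X a b)) (seq 0 n)) (seq 0 n)).

(* Sampling pattern: a list of n*n booleans; delta_ab = entry a*n+b. *)
Definition delta_of (n : nat) (l : list bool) : nat -> nat -> bool :=
  fun a b => nth (a * n + b) l false.

Definition POmega_minus_p (delta : nat -> nat -> bool) (p : R) (X : mat) : mat :=
  fun a b => (if delta a b then X a b else 0) - p * X a b.

Fixpoint all_bool_lists (k : nat) : list (list bool) :=
  match k with
  | O => [ [] ]
  | S k' => flat_map (fun l => [true :: l; false :: l]) (all_bool_lists k')
  end.

Definition weight (p : R) (l : list bool) : R :=
  fold_right Rmult 1 (map (fun b : bool => if b then p else 1 - p) l).

Definition bern_prob (n : nat) (p : R) (E : (nat -> nat -> bool) -> Prop) : R :=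
  fold_right Rplus 0
    (map (fun l => weight p l *
                   (if excluded_middle_informative (E (delta_of n l)) then 1 else 0))
         (all_bool_lists (n * n))).

(* Main.v *)
(** Moment method. With M the matrix of entries (delta_ab - p) X_ab and
    |X_ab| <= 1, expand E tr (M^T M)^k as a sum over walks of 2k steps.  The
    entries are independent and centered, and an entry used m >= 2 times
    contributes at most p.  Give each step a weight mu >= 1 and each distinct
    entry a weight q = p / mu^2: entries used once vanish, and p <= mu^m q for
    the others.  A new entry then offers n choices of weight q and an old one
    at most 2k choices, so the sum is at most n mu^(2k) (n q + 2k)^(2k).  With
    mu^2 = 2np/k this is n (25npk/2)^k.  This crude count is enough because
    k, a power of two close to beta log n, is at most 2np; Markov's inequality
    at the level t^2 = 225 np beta log n leaves n 9^(-k) <= n^(-beta). *)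

From Stdlib Require Import Reals Psatz ClassicalEpsilon.
From mathcomp Require Import all_boot all_order all_algebra.
From mathcomp Require Import ring lra zify.
From mathcomp Require Import Rstruct.
From Stdlib Require List.
Require Import Defs.

Set Implicit Arguments.
Unset Strict Implicit.
Unset Printing Implicit Defensive.

Import Order.TTheory GRing.Theory Num.Theory.
Local Open Scope nat_scope.
Local Open Scope ring_scope.

(** * Expectation over independent Bernoulli variables *)

Lemma big_flat_map (V : nmodType) (A B : Type) (s : seq A) (f : A -> seq B)
    (G : B -> V) :
  \sum_(b <- List.flat_map f s) G b = \sum_(a <- s) \sum_(b <- f a) G b.
Proof. by elim: s => [|a s IH] /=; rewrite ?big_nil // big_cons big_cat IH. Qed.

Section Expectation.
Variables (F : realFieldType) (p : F).

Definition bern_weight (l : seq bool) : F :=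
  \prod_(b <- l) (if b then p else 1 - p).

Definition expect (N : nat) (f : seq bool -> F) : F :=
  \sum_(l <- all_bool_lists N) bern_weight l * f l.

Lemma eq_expect N (f g : seq bool -> F) :
  (forall l, f l = g l) -> expect N f = expect N g.
Proof. by move=> fg; apply: eq_bigr => l _; rewrite fg. Qed.

Lemma expectZ N (c : F) (f : seq bool -> F) :
  expect N (fun l => c * f l) = c * expect N f.
Proof. by rewrite /expect mulr_sumr; apply: eq_bigr => l _; rewrite mulrCA. Qed.

Lemma expectS N (f : seq bool -> F) :
  expect N.+1 f = p * expect N (fun l => f (true :: l))
                + (1 - p) * expect N (fun l => f (false :: l)).
Proof.
rewrite /expect /= big_flat_map !mulr_sumr -big_split /=; apply: eq_bigr => l _.
by rewrite !big_cons big_nil /bern_weight !big_cons addr0 !mulrA.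
Qed.

(** Independence, by splitting off the first coordinate. *)
Lemma expect_prod N (g : nat -> bool -> F) :
  expect N (fun l => \prod_(j < N) g j (nth false l j))
  = \prod_(j < N) (p * g j true + (1 - p) * g j false).
Proof.
elim: N g => [|N IH] g.
  by rewrite /expect big_seq1 /bern_weight big_nil !big_ord0 mulr1.
rewrite expectS big_ord_recl -(IH (fun j => g j.+1)).
rewrite [RHS]mulrDl -!mulrA; congr (_ * _ + _ * _);
  by rewrite -expectZ; apply: eq_expect => l; rewrite big_ord_recl.
Qed.

Lemma expect1 N : expect N (fun=> 1) = 1.
Proof.
have := expect_prod N (fun _ _ => 1); rewrite [RHS]big1 => [one|j _]; last by ring.
by rewrite -[RHS]one; apply: eq_expect => l; rewrite big1.
Qed.

Lemma expect_sum N n (f : 'I_n -> seq bool -> F) :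
  expect N (fun l => \sum_(i < n) f i l) = \sum_(i < n) expect N (f i).
Proof.
rewrite /expect exchange_big /=; apply: eq_bigr => l _.
by rewrite mulr_sumr.
Qed.

Lemma expectB N (f g : seq bool -> F) :
  expect N (fun l => f l - g l) = expect N f - expect N g.
Proof. by rewrite /expect -sumrB; apply: eq_bigr => l _; rewrite mulrBr. Qed.

Hypothesis p01 : 0 <= p <= 1.

Lemma ler_expect N (f g : seq bool -> F) :
  (forall l, f l <= g l) -> expect N f <= expect N g.
Proof.
case/andP: p01 => p0 p1 fg; apply: ler_sum => l _; apply: ler_wpM2l => //.
by apply: prodr_ge0 => b _; case: ifP; rewrite ?subr_ge0.
Qed.

Lemma prod_count_mem N (h : seq nat) (f : nat -> F) : all (fun e => (e < N)%N) h ->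
  \prod_(e <- h) f e = \prod_(j < N) f j ^+ count_mem (val j) h.
Proof.
elim: h => [_|e h IH] /=; first by rewrite big_nil big1.
case/andP=> eN /IH {}IH; rewrite big_cons IH.
under [RHS]eq_bigr => j _ do rewrite exprD.
rewrite big_split /=; congr (_ * _).
rewrite (bigD1 (Ordinal eN)) //= eqxx expr1 big1 ?mulr1 // => j.
by rewrite -val_eqE eq_sym /= => /negPf ->.
Qed.

(** The centered moment is 1 for m = 0, vanishes for m = 1, and is at most p <= q mu^2 <= q mu^m for
    m >= 2. The boolean exponent charges [q] once per entry, however often it is used. *)
Lemma centered_moment_le (m : nat) (mu q : F) :
  1 <= mu -> p <= q * mu ^+ 2 ->
  `|p * (1 - p) ^+ m + (1 - p) * (0 - p) ^+ m| <= mu ^+ m * q ^+ (0 < m)%N.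
Proof.
case/andP: p01 => p0 p1 mu1 pq.
have mu2 : 0 < mu ^+ 2 by apply: exprn_gt0; lra.
have q0 : 0 <= q by rewrite -(pmulr_lge0 _ mu2) (le_trans p0).
case: m => [|[|m]]; first by rewrite !expr0 !mulr1 subrKC normr1.
  have -> : p * (1 - p) ^+ 1 + (1 - p) * (0 - p) ^+ 1 = 0 by ring.
  by rewrite normr0 !expr1 mulr_ge0 //; lra.
apply: (@le_trans _ _ p).
  have a0 : 0 <= (1 - p) ^+ m by apply: exprn_ge0; lra.
  have a1 : (1 - p) ^+ m <= 1 by apply: exprn_ile1; lra.
  have b0 : 0 <= p ^+ m by apply: exprn_ge0.
  have b1 : p ^+ m <= 1 by apply: exprn_ile1.
  apply: (le_trans (ler_normD _ _)).
  rewrite sub0r normrM [X in _ + X]normrM !normrX normrN !ger0_norm ?subr_ge0 // !exprSr.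
  move: ((1 - p) ^+ m) (p ^+ m) a0 a1 b0 b1 => a b a0 a1 b0 b1.
  have pp0 : 0 <= p * (1 - p) by nra.
  have : p * (1 - p) * (1 - p) * a <= p * (1 - p) * (1 - p).
    by apply: ler_piMr; rewrite // mulr_ge0 // subr_ge0.
  have : p * (1 - p) * p * b <= p * (1 - p) * p.
    by apply: ler_piMr; rewrite // mulr_ge0.
  nra.
rewrite expr1 mulrC -addn2 exprD.
have : 1 <= mu ^+ m by apply: exprn_ege1.
nra.
Qed.

(** Grouping equal indices turns the product into powers of independent variables, each bounded by
    its centered moment; the multiplicities add up to [size h], the indices present to
    [size (undup h)]. *)
Lemma expect_noise_prod_le N (h : seq nat) (mu q : F) :
  1 <= mu -> p <= q * mu ^+ 2 -> all (fun e => (e < N)%N) h ->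
  `|expect N (fun l => \prod_(e <- h) ((nth false l e)%:R - p))|
  <= mu ^+ size h * q ^+ size (undup h).
Proof.
move=> mu1 pq hN.
under eq_expect => l do rewrite (prod_count_mem _ hN).
rewrite (expect_prod N (fun j b => (b%:R - p) ^+ count_mem j h)) normr_prod.
have -> : mu ^+ size h * q ^+ size (undup h)
    = \prod_(j < N) (mu ^+ count_mem (val j) h * q ^+ (0 < count_mem (val j) h)%N).
  rewrite big_split /= -(prod_count_mem (fun=> mu)) //.
  have hN' : all (fun e => (e < N)%N) (undup h).
    by apply/allP => e; rewrite mem_undup => /(allP hN).
  have cst (s : seq nat) (c : F) : c ^+ size s = \prod_(e <- s) c.
    by rewrite big_const_seq count_predT iter_mulr_1.
  rewrite !cst; congr (_ * _).
  rewrite (prod_count_mem (fun=> q) hN'); apply: eq_bigr => j _.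
  by rewrite count_uniq_mem ?undup_uniq // mem_undup -has_pred1 has_count.
apply: ler_prod => j _; rewrite normr_ge0 /=.
exact: centered_moment_le.
Qed.
End Expectation.

(** * Trace moments as sums over walks *)

Section Walks.
Variables (F : realFieldType) (p : F) (n : nat) (X : 'M[F]_n).
Hypothesis p01 : 0 <= p <= 1.
Hypothesis X1 : forall a b, `|X a b| <= 1.

Definition noise (l : seq bool) (e : nat) : F := (nth false l e)%:R - p.

Definition noise_mx (l : seq bool) : 'M[F]_n :=
  \matrix_(a, b) (noise l (a * n + b) * X a b).

(* Odd steps go from columns to rows: walks alternate between [M] and [M^T]. *)
Definition oriented (V : Type) (r : nat) (f : 'I_n -> 'I_n -> V) (a b : 'I_n) : V :=
  if odd r then f b a else f a b.

Definition step_index (r : nat) : 'I_n -> 'I_n -> nat :=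
  oriented r (fun a b : 'I_n => (a * n + b)%N).

(** The (a, i) entry sums the weights of the walks of [r] steps from a to i. Steps are numbered
    downwards, so for even [r] the leftmost factor is M^T. *)
Fixpoint walk_mx (r : nat) (l : seq bool) : 'M[F]_n :=
  if r is r'.+1 then
    (\matrix_(a, b) oriented r' (noise_mx l) a b) *m walk_mx r' l
  else 1%:M.

Lemma walk_mx_even k l :
  walk_mx k.*2 l = ((noise_mx l)^T *m noise_mx l) ^+ k.
Proof.
elim: k => [|k IH]; first by [].
rewrite doubleS exprS -IH /= mulmxA; congr (_ *m _ *m _);
  by apply/matrixP => a b; rewrite !mxE /oriented /= odd_double /= ?mxE.
Qed.

Lemma step_index_lt r a b : (step_index r a b < n * n)%N.
Proof.
have lt (c d : 'I_n) : (c * n + d < n * n)%N.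
  by have := ltn_ord c; have := ltn_ord d; nia.
by rewrite /step_index /oriented; case: ifP => _; apply: lt.
Qed.

(** From a given vertex, the entry used determines the next vertex; hence reusing an old entry
    leaves few choices. *)
Lemma step_index_inj r a : injective (step_index r a).
Proof.
move=> b c; rewrite /step_index /oriented; case: ifP => _ bc; apply: ord_inj.
  have n0 : (0 < n)%N by apply: leq_ltn_trans (ltn_ord a).
  by move: bc => /= /eqP; rewrite eqn_add2r eqn_pmul2r // => /eqP.
exact: addnI bc.
Qed.

Lemma sum_mem_le_size (f : 'I_n -> nat) (h : seq nat) : injective f ->
  (\sum_(b < n) (f b \in h) <= size h)%N.
Proof.
move=> f_inj; pose s := [seq f b | b <- enum [pred b | f b \in h]].
have -> : (\sum_(b < n) (f b \in h) = size s)%N.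
  rewrite size_map -cardE -sum1_card [RHS]big_mkcond.
  by apply: eq_bigr => b _; rewrite inE; case: ifP.
apply: uniq_leq_size; first by rewrite map_inj_uniq // enum_uniq.
by move=> e /mapP [b]; rewrite mem_enum => bh ->.
Qed.

(** At most n vertices are reached by a fresh entry, each gaining a factor [q]; by injectivity at
    most [size h] are reached by an old one, each with factor 1. *)
Lemma sum_fresh_le (r : nat) (a : 'I_n) (h : seq nat) (q : F) : 0 <= q ->
  \sum_(b < n) q ^+ size (undup (step_index r a b :: h))
  <= q ^+ size (undup h) * (n%:R * q + (size h)%:R).
Proof.
move=> q0.
have le_b b : q ^+ size (undup (step_index r a b :: h))
    <= q ^+ size (undup h) * (q + (step_index r a b \in h)%:R).
  have qh := exprn_ge0 (size (undup h)) q0.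
  rewrite /=; case: ifP => _ /=; last by rewrite addr0 exprSr.
  by rewrite mulrDr mulr1 lerDr mulr_ge0.
apply: (le_trans (ler_sum _ (fun b _ => le_b b))).
rewrite -mulr_sumr ler_wpM2l ?exprn_ge0 // big_split /=.
rewrite sumr_const card_ord mulr_natl lerD2l -natr_sum ler_nat.
exact: sum_mem_le_size (@step_index_inj r a).
Qed.

(* The walk is unfolded one step at a time; [h] records the entries
   used so far.  A first use of an entry costs a factor [q], and a repeated
   use leaves at most [size h] choices for the next vertex. *)
Lemma expect_walk_le (mu q : F) (r : nat) (h : seq nat) (a i : 'I_n) :
  1 <= mu -> 0 <= q -> p <= q * mu ^+ 2 -> all (fun e => (e < n * n)%N) h ->
  `|expect p (n * n) (fun l => (\prod_(e <- h) noise l e) * walk_mx r l a i)|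
  <= mu ^+ (size h + r) * q ^+ size (undup h)
     * (n%:R * q + (size h + r)%:R) ^+ r.
Proof.
move=> mu1 q0 pq; have mu0 : 0 <= mu by apply: le_trans mu1.
elim: r h a => [|r IH] h a hN.
  rewrite addn0 expr0 mulr1.
  under eq_expect => l do rewrite /= mxE mulrC.
  rewrite expectZ normrM; case: (a == i); rewrite ?normr1 ?mul1r.
    exact: expect_noise_prod_le.
  by rewrite normr0 mul0r mulr_ge0 ?exprn_ge0.
pose x b := oriented r X a b; pose e b := step_index r a b.
have split_step l : (\prod_(e <- h) noise l e) * walk_mx r.+1 l a i
    = \sum_(b < n) x b * ((\prod_(e <- e b :: h) noise l e) * walk_mx r l b i).
  rewrite /= mxE mulr_sumr; apply: eq_bigr => b _.
  rewrite big_cons mxE /x /e /step_index /oriented.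
  by case: ifP => _; rewrite mxE; ring.
under eq_expect => l do rewrite split_step.
rewrite expect_sum; apply: (le_trans (ler_norm_sum _ _ _)).
(* A step moves one unit from the remaining length to the history, so [G] is the same in the
   induction hypothesis. *)
set G := n%:R * q + (size h + r.+1)%:R.
have G0 : 0 <= G by rewrite addr_ge0 ?mulr_ge0.
have le_b b : `|expect p (n * n) (fun l =>
      x b * ((\prod_(e <- e b :: h) noise l e) * walk_mx r l b i))|
    <= mu ^+ (size h + r.+1) * G ^+ r * q ^+ size (undup (e b :: h)).
  rewrite expectZ normrM -[leRHS]mul1r; apply: ler_pM => //.
    by rewrite /x /oriented; case: ifP.
  have ebN : all (fun e => (e < n * n)%N) (e b :: h) by rewrite /= step_index_lt.
  by have := IH _ b ebN; rewrite [size (e b :: h)]/= -/G addSnnS mulrAC.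
apply: (le_trans (ler_sum _ (fun b _ => le_b b))).
rewrite -mulr_sumr exprSr mulrACA mulrA [leRHS]mulrC.
set A := mu ^+ _; set S := \sum_(b < n) _; set Q := q ^+ _.
have -> : G * (A * G ^+ r * Q) = A * G ^+ r * (Q * G) by ring.
rewrite ler_wpM2l ?mulr_ge0 ?exprn_ge0 //.
apply: (le_trans (sum_fresh_le _ _ _ q0)).
by rewrite ler_wpM2l ?exprn_ge0 // lerD2l ler_nat leq_addr.
Qed.

Lemma expect_trace_le (mu q : F) (k : nat) :
  1 <= mu -> 0 <= q -> p <= q * mu ^+ 2 ->
  expect p (n * n) (fun l => \tr (((noise_mx l)^T *m noise_mx l) ^+ k))
  <= n%:R * (mu ^+ k.*2 * (n%:R * q + k.*2%:R) ^+ k.*2).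
Proof.
move=> mu1 q0 pq; rewrite expect_sum mulr_natl -[X in _ *+ X]card_ord -sumr_const.
apply: ler_sum => i _; apply: (le_trans (ler_norm _)).
have := @expect_walk_le mu q k.*2 [::] i i mu1 q0 pq isT.
rewrite /= expr0 mulr1 add0n; apply: le_trans.
rewrite le_eqVlt; apply/orP; left; apply/eqP; congr `|_|.
by apply: eq_expect => l; rewrite big_nil mul1r walk_mx_even.
Qed.
End Walks.

(** * From trace moments to the spectral norm *)

Section SpectralNorm.
Variables (F : realFieldType).

(** Lagrange's identity: the double sum of squares is twice the defect. *)
Lemma sum_cauchy_schwarz (n : nat) (f g : 'I_n -> F) :
  (\sum_i f i * g i) ^+ 2 <= (\sum_i f i ^+ 2) * (\sum_i g i ^+ 2).
Proof.
have : 0 <= \sum_i \sum_j (f i * g j - f j * g i) ^+ 2.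
  by apply: sumr_ge0 => i _; apply: sumr_ge0 => j _; apply: sqr_ge0.
have -> : \sum_i \sum_j (f i * g j - f j * g i) ^+ 2
  = 2 * ((\sum_i f i ^+ 2) * (\sum_i g i ^+ 2) - (\sum_i f i * g i) ^+ 2).
  have e1 (u v : 'I_n -> F) : (\sum_i u i) * (\sum_i v i) = \sum_i \sum_j u i * v j.
    by rewrite mulr_suml; apply: eq_bigr => i _; rewrite mulr_sumr.
  rewrite expr2 mulrBr mulr_natl mulr2n {2}[(\sum_i f i ^+ 2) * _]mulrC !e1 mulr_sumr.
  rewrite -big_split -sumrB /=; apply: eq_bigr => i _.
  rewrite mulr_sumr -big_split -sumrB /=; apply: eq_bigr => j _; ring.
by rewrite pmulr_rge0 // subr_ge0.
Qed.

Definition dot (n : nat) (u v : 'cV[F]_n) : F := \sum_i u i 0 * v i 0.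

Lemma dotE n (u v : 'cV[F]_n) : (u^T *m v) 0 0 = dot u v.
Proof. by rewrite mxE; apply: eq_bigr => i _; rewrite mxE. Qed.

Lemma dot_ge0 n (u : 'cV[F]_n) : 0 <= dot u u.
Proof. by apply: sumr_ge0 => i _; rewrite -expr2 sqr_ge0. Qed.

Lemma dot_cauchy_schwarz n (u v : 'cV[F]_n) : dot u v ^+ 2 <= dot u u * dot v v.
Proof. exact: sum_cauchy_schwarz. Qed.

Lemma dot_mull n (A : 'M[F]_n) (u v : 'cV[F]_n) : dot (A *m u) v = dot u (A^T *m v).
Proof. by rewrite -!dotE trmx_mul mulmxA. Qed.

Lemma dot_mul_le_frobenius n (A : 'M[F]_n) (u : 'cV[F]_n) :
  dot (A *m u) (A *m u) <= \tr (A^T *m A) * dot u u.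
Proof.
rewrite mxtrace_mulC {1}/dot mulr_suml; apply: ler_sum => i _; rewrite -expr2 !mxE.
have /le_trans := sum_cauchy_schwarz (A i) (u^~ 0); apply.
have -> : \sum_j A i j * A^T j i = \sum_j A i j ^+ 2.
  by apply: eq_bigr => j _; rewrite mxE.
by [].
Qed.

Lemma trmx_sym_exp n (A : 'M[F]_n) k : A^T = A -> (A ^+ k)^T = A ^+ k.
Proof.
move=> sA; elim: k => [|k IH]; first by rewrite expr0 trmx1.
rewrite exprS trmx_mul IH sA -exprS; exact/esym/exprSr.
Qed.

(** Takes the place of diagonalization: Cauchy-Schwarz is iterated, doubling the power of A each
    time, which is why the exponents are powers of two. *)
Lemma quad_pow2_le n (A : 'M[F]_n) (u : 'cV[F]_n) r : A^T = A -> 0 <= dot u (A *m u) ->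
  dot u (A *m u) ^+ (2 ^ r.+1) <= \tr (A ^+ (2 ^ r.+1)) * dot u u ^+ (2 ^ r.+1).
Proof.
move=> sA Au0.
(* Cauchy-Schwarz gives [(u, A^m u)^2 <= (u, u) (u, A^(2m) u)]; the exponent
   is kept as [(2 ^ s).-1] to avoid dividing by [dot u u]. *)
have pow2 s : dot u (A *m u) ^+ (2 ^ s)
              <= dot u u ^+ (2 ^ s).-1 * dot u (A ^+ (2 ^ s) *m u).
  elim: s => [|s IH]; first by rewrite expr0 mul1r.
  have -> : ((2 ^ s.+1).-1 = (2 ^ s).-1 * 2 + 1)%N.
    by rewrite expnSr; have := expn_gt0 2 s; lia.
  rewrite expnSr !exprM exprD exprM expr1 -mulrA.
  apply: (@le_trans _ _ ((dot u u ^+ (2 ^ s).-1 * dot u (A ^+ (2 ^ s) *m u)) ^+ 2)).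
    by rewrite lerXn2r // nnegrE ?exprn_ge0 // (le_trans _ IH) ?exprn_ge0.
  rewrite exprMn ler_wpM2l ?exprn_ge0 ?dot_ge0 //.
  apply: (le_trans (dot_cauchy_schwarz _ _)).
  by rewrite dot_mull trmx_sym_exp // mulmxA.
apply: (le_trans (pow2 r.+1)).
have -> : dot u u ^+ (2 ^ r.+1) = dot u u ^+ (2 ^ r.+1).-1 * dot u u.
  by rewrite -exprSr prednK // expn_gt0.
rewrite mulrCA ler_wpM2l ?exprn_ge0 ?dot_ge0 //.
(* By symmetry (u, A^(2m) u) = |A^m u|^2 with m = 2^r, and the squared Frobenius norm of A^m is the
   trace of A^(2m). *)
have := dot_mul_le_frobenius (A ^+ (2 ^ r)) u.
have -> : A ^+ (2 ^ r.+1) = A ^+ (2 ^ r) *m A ^+ (2 ^ r).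
  by rewrite expnS mul2n -addnn exprD.
by rewrite dot_mull trmx_sym_exp // mulmxA.
Qed.

Lemma spectral_of_trace_lt (n r : nat) (M : 'M[F]_n) (T : F) : 0 <= T ->
  \tr ((M^T *m M) ^+ (2 ^ r.+1)) < T ^+ (2 ^ r.+1) ->
  forall u, dot (M *m u) (M *m u) <= T * dot u u.
Proof.
move=> T0 trT u; set A := M^T *m M in trT.
have Au : dot (M *m u) (M *m u) = dot u (A *m u) by rewrite dot_mull mulmxA.
have A0 : 0 <= dot u (A *m u) by rewrite -Au dot_ge0.
have sA : A^T = A by rewrite /A trmx_mul trmxK.
rewrite Au -(@ler_pXn2r _ (2 ^ r.+1)) ?nnegrE ?mulr_ge0 ?dot_ge0 ?expn_gt0 //.
apply: (le_trans (quad_pow2_le r sA A0)).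
by rewrite exprMn ler_wpM2r ?exprn_ge0 ?dot_ge0 // ltW.
Qed.

Lemma trace_pow2_ge0 (n r : nat) (M : 'M[F]_n) :
  0 <= \tr ((M^T *m M) ^+ (2 ^ r.+1)).
Proof.
set A := M^T *m M; have sA : A^T = A by rewrite /A trmx_mul trmxK.
have -> : A ^+ (2 ^ r.+1) = A ^+ (2 ^ r) *m (A ^+ (2 ^ r))^T.
  by rewrite trmx_sym_exp // expnS mul2n -addnn exprD.
apply: sumr_ge0 => i _; rewrite mxE; apply: sumr_ge0 => j _.
by rewrite mxE -expr2 sqr_ge0.
Qed.

(** Markov's inequality: [good], standing for the indicator of the event, dominates 1 - tr / T^k
    pointwise. Where tr < T^k the spectral bound holds; elsewhere the minorant is at most 0. *)
Lemma expect_spectral_ge (p : F) (n r : nat) (X : 'M[F]_n) (mu q T : F)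
    (good : seq bool -> F) :
  0 <= p <= 1 -> (forall a b, `|X a b| <= 1) ->
  1 <= mu -> 0 <= q -> p <= q * mu ^+ 2 -> 0 < T ->
  (forall l, 0 <= good l) ->
  (forall l,
     (forall u, dot (noise_mx p X l *m u) (noise_mx p X l *m u) <= T * dot u u) ->
     1 <= good l) ->
  1 - n%:R * (mu ^+ 2 * (n%:R * q + (2 ^ r.+1).*2%:R) ^+ 2 / T) ^+ (2 ^ r.+1)
  <= expect p (n * n) good.
Proof.
move=> p01 X1 mu1 q0 pq T0 good0 good1; set k := (2 ^ r.+1)%N.
pose tr l := \tr (((noise_mx p X l)^T *m noise_mx p X l) ^+ k).
have TK : 0 < T ^+ k by rewrite exprn_gt0.
apply: (@le_trans _ _ (expect p (n * n) (fun l => 1 - (T ^+ k)^-1 * tr l))); last first.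
  apply: ler_expect => // l; case: (ltP (tr l) (T ^+ k)) => trT.
    apply: le_trans (good1 l (spectral_of_trace_lt (ltW T0) trT)).
    by rewrite lerBlDr lerDl mulr_ge0 ?invr_ge0 ?(ltW TK) ?trace_pow2_ge0.
  apply: le_trans (good0 l); rewrite subr_le0 mulrC ler_pdivlMr //.
  by rewrite mul1r.
rewrite expectB expect1 expectZ lerD2l lerN2 mulrC ler_pdivrMr //.
apply: (le_trans (expect_trace_le p01 X1 k mu1 q0 pq)).
rewrite -[leRHS]mulrA ler_wpM2l //.
by rewrite -[leRHS]exprMn divfK ?gt_eqF // exprMn -!exprM mul2n.
Qed.
End SpectralNorm.

(** * Choice of the parameters *)

(** Here mu^2 = 2Np/k and q = k/(2N), so Nq + 2k = 5k/2 and the numerator is 25Npk/2; the ratio is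
    k/(18L), at most 1/9 when k <= 2L. *)
Lemma moment_ratio_le (F : realFieldType) (N p L k : F) :
  0 < N -> 0 < p -> 0 < L -> 0 < k -> k <= 2 * L ->
  0 <= (2 * N * p / k) * (N * (k / (2 * N)) + 2 * k) ^+ 2 / (225 * (N * p * L)) <= 9^-1.
Proof.
move=> N0 p0 L0 k0 kL.
have -> : (2 * N * p / k) * (N * (k / (2 * N)) + 2 * k) ^+ 2 / (225 * (N * p * L))
          = k / (18 * L).
  by field; rewrite !gt_eqF.
have L18 : 0 < 18 * L by rewrite mulr_gt0.
apply/andP; split; first by rewrite divr_ge0 ?ltW.
by rewrite ler_pdivrMr //; lra.
Qed.

(** Take the least power of two that is at least L. It is not 2^0 since L > 1, and by minimality its
    half is below L. *)
Lemma pow2_between (L : R) : 1 < L -> exists r, L <= (2 ^ r.+1)%:R <= 2 * L.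
Proof.
move=> L1; have L0 : 0 <= L by apply: ltW; apply: lt_trans L1.
have ex : exists m, L <= (2 ^ m)%:R.
  exists (Num.bound L); apply: ltW; apply: lt_trans (archi_boundP L0) _.
  by rewrite ltr_nat ltn_expl.
case: (ex_minnP ex) => -[|r]; first by rewrite expn0 leNgt L1.
move=> Lr min; exists r; rewrite Lr /= expnS natrM ler_wpM2l // ltW // ltNge.
by apply/negP => /min; rewrite ltnn.
Qed.

(** * Passage from lists and functions to big sums and matrices *)

Lemma fold_right_map_bigE (T : Type) (op : R -> R -> R) (x : R) (f : T -> R)
    (s : list T) :
  List.fold_right op x (List.map f s) = \big[op/x]_(i <- s) f i.
Proof. by elim: s => [|a s IH]; rewrite ?big_nil // big_cons -IH. Qed.

Lemma rsumE (n : nat) (f : nat -> R) : rsum n f = \sum_(i < n) f i.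
Proof.
have seqE m k : List.seq m k = iota m k by elim: k m => //= k IH m; rewrite IH.
by rewrite /rsum fold_right_map_bigE seqE -(big_mkord xpredT) /index_iota subn0.
Qed.

Lemma bern_probE (n : nat) (p : R) (E : (nat -> nat -> bool) -> Prop) :
  bern_prob n p E = expect p (n * n)
    (fun l => if excluded_middle_informative (E (delta_of n l))
              then 1 else 0).
Proof.
rewrite /bern_prob fold_right_map_bigE; apply: eq_bigr => l _.
by rewrite /weight fold_right_map_bigE; case: excluded_middle_informative.
Qed.

Lemma delta_ofE (n : nat) (l : seq bool) (a b : nat) :
  delta_of n l a b = nth false l (a * n + b).
Proof.
have nthE m : List.nth m l false = nth false l m by elim: l m => [|c l IH] [|m] /=.
exact: nthE.
Qed.

Lemma vnormE (n : nat) (x : vec) (u := \col_(i < n) x i) : vnorm n x = sqrt (dot u u).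
Proof. by rewrite /vnorm rsumE; congr sqrt; apply: eq_bigr => i _; rewrite !mxE. Qed.

Lemma infnorm_ge0 (n : nat) (X : mat) : 0 <= infnorm n X.
Proof.
apply/RleP; rewrite /infnorm; elim: List.flat_map => [|x s IH] /=; first by right.
exact: Rle_trans IH (Rmax_r _ _).
Qed.

Lemma le_infnorm (n : nat) (X : mat) (a b : 'I_n) : `|X a b| <= infnorm n X.
Proof.
have le_fold (s : list R) x : List.In x s -> Rle x (List.fold_right Rmax R0 s).
  elim: s => //= y s IH [-> | /IH xs]; first exact: Rmax_l.
  exact: Rle_trans xs (Rmax_r _ _).
rewrite -RabsE; apply/RleP/le_fold/List.in_flat_map.
have in_seq (c : 'I_n) : List.In (c : nat) (List.seq 0 n).
  by apply/List.in_seq; have := ltn_ord c; lia.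
by exists a; split=> //; apply/List.in_map_iff; exists b.
Qed.

(* If [infnorm n X = 0], then [X a b / 0 = 0] and both sides vanish. *)
Lemma POmega_minus_pE (n : nat) (p : R) (l : seq bool) (X : mat) (a b : 'I_n)
    (Y := \matrix_(a < n, b < n) (X a b / infnorm n X)) :
  POmega_minus_p (delta_of n l) p X a b = infnorm n X * noise_mx p Y l a b.
Proof.
have XY : X a b = infnorm n X * Y a b.
  have := le_infnorm X a b; rewrite mxE mulrC; have [-> | K0 _] := eqVneq (infnorm n X) 0.
    by rewrite normr_le0 => /eqP ->; rewrite mulr0.
  by rewrite divfK.
rewrite /POmega_minus_p delta_ofE mxE /noise.
rewrite -[X in _ = X]mulrCA -XY mulrBl.
by case: nth; rewrite /= ?mul1r ?mul0r.
Qed.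

(** The matrix is [infnorm n X / p] times the noise matrix of the normalized [Y], so a bound on
    squared norms scales by the square of that factor. *)
Lemma specnorm_le_scaled_noise (n : nat) (p T t : R) (l : seq bool) (X : mat)
    (Y := \matrix_(a < n, b < n) (X a b / infnorm n X)) :
  0 <= t -> (infnorm n X / p) ^+ 2 * T <= t ^+ 2 ->
  (forall u, dot (noise_mx p Y l *m u) (noise_mx p Y l *m u) <= T * dot u u) ->
  specnorm_le n (fun a b => Rmult (Rinv p) (POmega_minus_p (delta_of n l) p X a b)) t.
Proof.
move=> t0 Tt MT x; rewrite !vnormE; set u := \col_i x i; set v := \col_i _.
have -> : v = (infnorm n X / p) *: (noise_mx p Y l *m u).
  apply/matrixP => i j; rewrite 3!mxE /matvec rsumE mulr_sumr.
  apply: eq_bigr => b _; rewrite POmega_minus_pE -/Y [u b j]mxE !RmultE RinvE.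
  by ring.
have dotZ (c : R) (w : 'cV[R]_n) : dot (c *: w) (c *: w) = c ^+ 2 * dot w w.
  by rewrite /dot mulr_sumr; apply: eq_bigr => i _; rewrite !mxE; ring.
have -> : t = sqrt (t ^+ 2).
  by rewrite expr2 sqrt_square //; apply/RleP.
rewrite -sqrt_mult_alt; last by apply/RleP/exprn_ge0.
apply: sqrt_le_1_alt; apply/RleP; rewrite dotZ.
apply: (le_trans (ler_wpM2l (sqr_ge0 _) (MT u))).
by rewrite mulrA ler_wpM2r ?dot_ge0.
Qed.

(** * Probability bound and conclusion *)

Lemma bern_prob_specnorm_ge (n r : nat) (p L t : R) (X : mat) :
  0 < p <= 1 -> (0 < n)%N -> 1 <= L <= n%:R * p -> L <= (2 ^ r.+1)%:R <= 2 * L ->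
  0 <= t -> t ^+ 2 = 225 * (n%:R * L / p) * infnorm n X ^+ 2 ->
  1 - n%:R * 9^-1 ^+ (2 ^ r.+1) <= bern_prob n p (fun delta =>
    specnorm_le n (fun a b => Rmult (Rinv p) (POmega_minus_p delta p X a b)) t).
Proof.
move=> /andP[p0 p1] n0 /andP[L1 Lnp] /andP[Lk kL] t0 tE.
have N0 : 0 < n%:R :> R by rewrite ltr0n.
set k := (2 ^ r.+1)%:R : R in Lk kL.
have k0 : 0 < k by rewrite ltr0n expn_gt0.
have L0 : 0 < L by lra.
pose Y := \matrix_(a < n, b < n) (X a b / infnorm n X).
have Y1 a b : `|Y a b| <= 1.
  rewrite mxE normrM normfV (ger0_norm (infnorm_ge0 n X)).
  have [-> | K0] := eqVneq (infnorm n X) 0; first by rewrite invr0 mulr0.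
  by rewrite ler_pdivrMr ?mul1r ?le_infnorm // lt_def K0 infnorm_ge0.
have mu20 : 0 <= 2 * n%:R * p / k by rewrite !mulr_ge0 ?invr_ge0 // ltW.
pose mu := Num.sqrt (2 * n%:R * p / k).
have mu2 : mu ^+ 2 = 2 * n%:R * p / k by rewrite sqr_sqrtr.
(* Since k <= 2L <= 2np. *)
have mu1 : 1 <= mu.
  rewrite -[1]sqrtr1 ler_wsqrtr // ler_pdivlMr //; lra.
have q0 : 0 <= k / (2 * n%:R) by rewrite divr_ge0 ?mulr_ge0 // ltW.
have pq : p <= k / (2 * n%:R) * mu ^+ 2.
  by rewrite mu2 le_eqVlt; apply/orP; left; apply/eqP; field; rewrite !gt_eqF.
(* The level for squared norms; multiplied by ([infnorm n X] / p)^2 it is exactly t^2. *)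
have T0 : 0 < 225 * (n%:R * p * L) by rewrite !mulr_gt0.
rewrite bern_probE; set good := fun l : seq bool => _.
have p01 : 0 <= p <= 1 by rewrite (ltW p0).
apply: le_trans (expect_spectral_ge r p01 Y1 mu1 q0 pq T0 (good := good) _ _); last 2 first.
- by move=> l; rewrite /good; case: excluded_middle_informative.
- move=> l bound; rewrite /good; case: excluded_middle_informative => // -[].
  apply: specnorm_le_scaled_noise bound => //.
  by rewrite tE le_eqVlt; apply/orP; left; apply/eqP; field; rewrite gt_eqF.
rewrite lerD2l lerN2 ler_wpM2l // mu2 -mul2n natrM -/k.
have /andP[rho0 rho9] := moment_ratio_le N0 p0 L0 k0 kL.
by rewrite lerXn2r // nnegrE invr_ge0.
Qed.

Local Close Scope ring_scope.
Local Close Scope nat_scope.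
Open Scope R_scope.

Lemma ln_le (x y : R) : 0 < x -> x <= y -> ln x <= ln y.
Proof.
by move=> x0 [xy | ->]; [apply/Rlt_le/ln_increasing | right].
Qed.

(** As e <= 3, 9^(-k) <= e^(-2k) <= N^(-2 beta), and the spare factor N^(-beta) absorbs N. *)
Lemma geometric_tail_le (N beta : R) (k : nat) :
  1 <= N -> 2 < beta -> beta * ln N <= INR k ->
  N * (/ 9) ^ k <= Rpower N (- beta).
Proof.
move=> N1 beta2 Lk.
have lnN : 0 <= ln N by rewrite -ln_1; apply: ln_le => //; Lra.lra.
have e2 : / 9 <= exp (- (1 + 1)).
  rewrite exp_Ropp; apply: Rinv_le_contravar; first exact: exp_pos.
  by rewrite exp_plus; have := exp_le_3; have := exp_pos 1; Psatz.nra.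
have ek : (/ 9) ^ k <= exp (- (2 * INR k)).
  have -> : exp (- (2 * INR k)) = exp (- (1 + 1)) ^ k.
    rewrite -Rpower_pow; last exact: exp_pos.
    by rewrite /Rpower ln_exp; congr exp; Lra.lra.
  by apply: pow_incr; split=> //; Lra.lra.
rewrite /Rpower -{1}[N]exp_ln; last by Lra.lra.
apply: Rle_trans (Rmult_le_compat_l _ _ _ (Rlt_le _ _ (exp_pos _)) ek) _.
have bl : 0 <= (beta - 2) * ln N by apply: Rmult_le_pos; Lra.lra.
rewrite -exp_plus; have [] // : ln N + - (2 * INR k) <= - beta * ln N by Lra.lra.
  by move/exp_increasing/Rlt_le.
by move=> ->; right.
Qed.

Lemma bern_prob_spectral (n : nat) (p beta : R) (X : mat) :
  (2 <= n)%N -> 0 < p <= 1 -> 2 < beta -> beta * ln (INR n) <= INR n * p ->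
  1 - Rpower (INR n) (- beta) <=
  bern_prob n p (fun delta =>
    specnorm_le n (fun a b => / p * POmega_minus_p delta p X a b)
      (15 * sqrt (beta * INR n * ln (INR n) / p) * infnorm n X)).
Proof.
move=> n2 [p0 p1] beta2 npL; set N := INR n; set L := beta * ln N.
have N2 : 2 <= N by have -> : 2 = INR 2 by []; apply: le_INR; lia.
(* With beta > 2 this gives L > 1, as the choice of the power of two requires. *)
have lnN : / 2 < ln N.
  by apply: Rlt_le_trans ln_lt_2 _; apply: ln_le; Lra.lra.
have L1 : 1 < L by rewrite /L; Psatz.nra.
have [r kL] := pow2_between (introT RltP L1).
have Lk : L <= INR (2 ^ r.+1) by rewrite INRE; case/andP: kL => /RleP.
have NLp : 0 <= N * L / p by apply/Rlt_le/Rdiv_lt_0_compat => //; Psatz.nra.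
have -> : beta * N * ln N / p = N * L / p by rewrite /L /Rdiv; Lra.lra.
set s := sqrt _; have ss : s * s = N * L / p by apply: sqrt_sqrt.
set t := 15 * s * _.
have K0 : 0 <= infnorm n X by apply/RleP/infnorm_ge0.
have s0 : 0 <= s by apply: sqrt_pos.
have t0 : 0 <= t by apply: Rmult_le_pos K0; apply: Rmult_le_pos s0; Lra.lra.
have tE : (t ^+ 2 = 225 * (n%:R * L / p) * infnorm n X ^+ 2)%R.
  have e225 : (225%:R)%R = 225 by rewrite -INRE INR_IZR_INZ.
  rewrite e225 -INRE -/N -RdivE -!RpowE -!RmultE -ss /t; Psatz.nra.
have p01 : (0 < p <= 1)%R by apply/andP; split; [apply/RltP | apply/RleP].
have Lnp : (1 <= L <= n%:R * p)%R.
  by rewrite -INRE; apply/andP; split; apply/RleP => //; apply: Rlt_le.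
have n0 : (0 < n)%N by lia.
have /RleP ge := bern_prob_specnorm_ge p01 n0 Lnp kL (introT RleP t0) tE.
apply: Rle_trans ge; apply: Rplus_le_compat_l; apply: Ropp_le_contravar.
have -> : (9^-1)%R = / 9 by rewrite -RinvE -INRE INR_IZR_INZ.
by rewrite -RpowE -INRE -/N; apply: geometric_tail_le => //; Lra.lra.
Qed.

Theorem theorem6p1 :
  exists C0 : R,
    forall (n : nat) (p beta : R) (X : mat),
      0 < p <= 1 ->
      2 < beta ->
      INR n * p >= beta * ln (INR n) ->
      bern_prob n p
        (fun delta =>
           specnorm_le n (fun a b => / p * POmega_minus_p delta p X a b)
             (C0 * sqrt (beta * INR n * ln (INR n) / p) * infnorm n X))
      >= 1 - Rpower (INR n) (- beta).
Proof.
(* 15 is the square root of the constant 225 in the Markov level. *)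
exists 15 => n p beta X p01 beta2 npL; apply: Rle_ge.
have [n2 | n1] := leqP 2 n; first by apply: bern_prob_spectral => //; exact: Rge_le.
(* This includes n = 0, as [ln 0 = 0]. *)
have -> : Rpower (INR n) (- beta) = 1.
  have ln0 : ln (INR n) = 0.
    case: n n1 {X npL} => [|[|//]] _ /=; last exact: ln_1.
    by rewrite /ln; case: Rlt_dec => // lt00; case: (Rlt_irrefl _ lt00).
  by rewrite /Rpower ln0 Rmult_0_r exp_0.
(* For n <= 1 only nonnegativity of the probability remains. *)
rewrite Rminus_diag bern_probE; apply/RleP.
have p01' : (0 <= p <= 1)%R by case: p01 => /Rlt_le/RleP p0 /RleP p1; apply/andP.
have <- : expect p (n * n) (fun=> 0%R) = 0.
  rewrite -[RHS](mul0r (expect p (n * n) (fun=> 1%R))) -expectZ.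
  by apply: eq_expect => l; rewrite mul0r.
by apply: ler_expect => // l; case: excluded_middle_informative.
Qed.
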